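(* Let $G$ be a ribbon digraph with vertex set $V$, and let $(x,\varrho_x)$ and $(y,\varrho_y)$ be two chip-and-rotor configurations on $G$. Then $(x,\varrho_x)\leadsto(y,\varrho_y)$ if and only if $(y,\varrho_y)$ is reachable from $(x,\varrho_x)$ in the unconstrained sense and, for the routing reduced vector $r$ with $\pi_r(x,\varrho_x)=(y,\varrho_y)$, we have $$S_1=\{v\in V \mid y(v)<0 \text{ and } r(v)>0\}=\emptyset$$ and, for $T:=\{v\in V\mid y(v)=0\text{ and } r(v)>0\}$, $$S_2:=\{v\in T\mid \text{every vertex reachable from } v \text{ in } \varrho_y \text{ is contained in } T\}=\emptyset .$$
   Context: Digraphs are finite, multiple edges are allowed, loops are not. $\deg^+(v)$ is the out-degree of $v$, $d(u,v)$ is the number of edges from $u$ to $v$; a sink is a vertex of out-degree $0$. $L_G$ is the matrix with $(L_G)_{uu}=-\deg^+(u)$ and $(L_G)_{uv}=d(v,u)$ for $u\neq v$. A ribbon digraph is a digraph with a fixed cyclic ordering of the outgoing edges at each vertex; $e^+$ denotes the edge following $e$ in the cyclic order at the tail of $e$. A rotor configuration $\varrho$ assigns to each non-sink vertex $v$ an edge $\varrho(v)$ with tail $v$. Its rotor subgraph is the subgraph on $V$ with edge set $\{\varrho(v)\}$; ''reachable from $v$ in $\varrho$'' means reachable by a directed path (possibly of length $0$) in the rotor subgraph. A chip-and-rotor configuration is a pair $(x,\varrho)$ with $x\in\mathbb{Z}^{V}$ and $\varrho$ a rotor configuration. Routing at a non-sink $v$ replaces $\varrho(v)$ by $\varrho(v)^+$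 and $x$ by $x-\mathbf{1}_v+\mathbf{1}_{v'}$, where $v'$ is the head of $\varrho(v)^+$; routing at a sink has no effect. The routing at $v$ is legal if $x(v)>0$. A legal game is a finite sequence of configurations, each obtained from the previous one by a legal routing. $(x_1,\varrho_1)\leadsto(x_2,\varrho_2)$ means that there is a (possibly empty) legal game from $(x_1,\varrho_1)$ to $(x_2,\varrho_2)$. For $r\in\mathbb{Z}_{\ge0}^{V}$, $\pi_r(x,\varrho)$ is the configuration obtained from $(x,\varrho)$ by routing each vertex $v$ exactly $r(v)$ times irrespective of legality (the order does not matter). $(y,\varrho_y)$ is reachable from $(x,\varrho_x)$ in the unconstrained sense if $\pi_r(x,\varrho_x)=(y,\varrho_y)$ for some $r\in\mathbb{Z}_{\ge0}^{V}$. A period vector is $p\in\mathbb{Z}_{\ge0}^{V}$ with $L_Gp=0$. A routing period vector is a vector of the form $v\mapsto p(v)\deg^+(v)$ with $p$ a period vector. A vector $r\in\mathbb{Z}_{\ge0}^{V}$ is routing reduced if $r(v)=0$ for every sink $v$ and $r$ is not coordinatewise greater than or equal to any nonzero routing period vector. When $(y,\varrho_y)$ is reachable from $(x,\varrho_x)$ in the unconstrained sense, there is exactly one routing reduced $r$ with $\pi_r(x,\varrho_x)=(y,\varrho_y)$. *)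

(* Defs.v *)
From HB Require Import structures.
From mathcomp Require Import all_boot all_order all_algebra all_fingroup.
Set Implicit Arguments.
Unset Strict Implicit.
Unset Printing Implicit Defensive.
Import Order.TTheory GRing.Theory Num.Theory.
Local Open Scope ring_scope.

Record digraph := Digraph {
  vertex : finType;
  edge : finType;
  tail : edge -> vertex;
  head : edge -> vertex;
  no_loop : forall e, tail e != head e }.

Definition outdeg (G : digraph) (v : vertex G) : nat :=
  #|[set e : edge G | tail e == v]|.

Definition mult (G : digraph) (u v : vertex G) : nat :=
  #|[set e : edge G | (tail e == u) && (head e == v)]|.

Definition sink (G : digraph) (v : vertex G) : bool := outdeg v == 0%N.

Definition laplacian (G : digraph) (u v : vertex G) : int :=
  if u == v then - (outdeg u)%:Z else (mult v u)%:Z.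

(* [enext] is the map e |-> e^+; a cyclic ordering of the edges leaving each
   vertex is a permutation whose orbits are the sets of edges with a common
   tail. *)
Record ribbon_digraph := RibbonDigraph {
  base :> digraph;
  enext : {perm edge base};
  enext_cyclic : forall e f : edge base,
    (f \in porbit enext e) = (tail f == tail e) }.

Section ChipsAndRotors.
Variable G : ribbon_digraph.
Local Notation V := (vertex G).
Local Notation E := (edge G).

(* A rotor configuration is defined on the non-sink vertices only; it is encoded
   by an option-valued map taking the value None exactly at the sinks, and [conf]
   contains all pairs of a chip vector and an option-valued map. *)
Definition is_rotor (rho : {ffun V -> option E}) : bool :=
  [forall v, if rho v is Some e then tail e == v else sink v].

Definition conf : Type := ({ffun V -> int} * {ffun V -> option E})%type.

Definition route (v : V) (c : conf) : conf :=
  if c.2 v is Some e then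
    ([ffun u => c.1 u - (u == v)%:Z + (u == head (enext G e))%:Z],
     [ffun u => if u == v then Some (enext G e) else c.2 u])
  else c.

Definition legal_step (c c' : conf) : bool :=
  [exists v, (0 < c.1 v) && (c' == route v c)].

Definition leadsto (c c' : conf) : Prop :=
  exists2 s : seq conf, path legal_step c s & last c s = c'.

(* Routings at different vertices commute (lemma [routeC] below), so the order
   of [enum V] plays no role. *)
Definition multiroute (r : {ffun V -> nat}) (c : conf) : conf :=
  foldr (fun v => iter (r v) (route v)) c (enum V).

Definition unconstrained_reachable (c c' : conf) : Prop :=
  exists r : {ffun V -> nat}, multiroute r c = c'.

Definition period_vector (p : {ffun V -> nat}) : Prop :=
  forall u, \sum_v laplacian u v * (p v)%:Z = 0.

Definition routing_period_vector (q : {ffun V -> nat}) : Prop :=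
  exists2 p : {ffun V -> nat}, period_vector p
    & q = [ffun v => (p v * outdeg v)%N].

Definition routing_reduced (r : {ffun V -> nat}) : Prop :=
  (forall v, sink v -> r v = 0%N) /\
  (forall q, routing_period_vector q -> q <> [ffun=> 0%N] ->
     ~ (forall v, (q v <= r v)%N)).

Definition rotor_edge (rho : {ffun V -> option E}) : rel V :=
  [rel u w | if rho u is Some e then head e == w else false].

Definition S1 (y : {ffun V -> int}) (r : {ffun V -> nat}) : {set V} :=
  [set v | (y v < 0) && (0 < r v)%N].

Definition Tset (y : {ffun V -> int}) (r : {ffun V -> nat}) : {set V} :=
  [set v | (y v == 0) && (0 < r v)%N].

Definition S2 (y : {ffun V -> int}) (rho : {ffun V -> option E})
    (r : {ffun V -> nat}) : {set V} :=
  [set v in Tset y r | [forall w, connect (rotor_edge rho) v w ==> (w \in Tset y r)]].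

Lemma routeC (u v : V) (c : conf) : route u (route v c) = route v (route u c).
Proof.
have [->//|uv] := eqVneq u v; have vu : v != u by rewrite eq_sym.
rewrite /route; case Ev: (c.2 v) => [f|] /=; case Eu: (c.2 u) => [e|] /=;
  rewrite ?ffunE ?(negPf uv) ?(negPf vu) ?Eu ?Ev //=.
congr (_, _); apply/ffunP => w; rewrite !ffunE.
  by rewrite -!addrA; congr (_ + _); rewrite addrA [RHS]addrA addrC.
by case: (eqVneq w u) => [->|//]; rewrite (negPf uv).
Qed.

End ChipsAndRotors.

(* Main.v *)
(** Necessity: a legal game routing exactly the vertices with [s v > 0] leaves
    them with nonnegative chips, and every nonempty set of routed vertices
    closed under the final rotors contains a vertex with a positive number of
    chips: the rotor of the vertex of the set routed last points to a vertex of
    the set, which received a chip at that time. A routing reduced [r] with the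
    same effect satisfies [r <= s], so S1 and S2 are empty.

    Sufficiency: play greedily, routing only vertices with [r v > 0] and
    decrementing [r]. If the game is stuck on W = {r > 0}, then W holds at most 0
    chips; routing the remaining [r] cannot bring chips into W, while S1 = set0
    says that W ends up with nonnegative counts. So every count on W ends at 0
    and no chip leaves W; the final rotors thus map W to itself and W is
    contained in S2. *)
Require Import Defs.
From mathcomp Require Import all_boot all_order all_algebra all_fingroup.
From mathcomp Require Import zify.
Import Order.TTheory GRing.Theory Num.Theory.
Local Open Scope ring_scope.

Section RotorRouting.
Variable G : ribbon_digraph.
Local Notation V := (vertex G).
Local Notation E := (edge G).
Local Notation head := (@Defs.head G).
Implicit Types (u v w : V) (e : E) (o : option E) (r s : V -> nat) (c : conf G).

(** * Closed form of repeated routing *)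

Definition departures o n : nat := if o is Some _ then n else 0.

(** Routing turns the rotor before the chip moves, so [n] routings from rotor [e] use the iterates 1
    to [n] of [e], hence [i.+1]. *)
Definition arrivals o n u : nat :=
  if o is Some e then \sum_(i < n) (head (iter i.+1 (enext G) e) == u) else 0.

(** The joint effect of routing each [v] exactly [r v] times: the edges used at a vertex depend only
    on its own rotor, so no order is involved. *)
Definition fire r c : conf G :=
  ([ffun u => c.1 u - (departures (c.2 u) (r u))%:Z
              + (\sum_v arrivals (c.2 v) (r v) u)%:Z],
   [ffun v => omap (iter (r v) (enext G)) (c.2 v)]).

Lemma eq_fire r s c :
  (forall v, isSome (c.2 v) -> r v = s v) -> fire r c = fire s c.
Proof.
move=> rs; have eqc v : (departures (c.2 v) (r v) = departures (c.2 v) (s v)) *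
    (forall u, arrivals (c.2 v) (r v) u = arrivals (c.2 v) (s v) u) *
    (omap (iter (r v) (enext G)) (c.2 v) = omap (iter (s v) (enext G)) (c.2 v)).
  by move: (rs v); case: (c.2 v) => [e ->|].
congr (_, _); apply/ffunP => u; rewrite !ffunE ?eqc //.
by congr (_ + Posz _); apply: eq_bigr => v _; rewrite eqc.
Qed.

Lemma fire0 r c : (forall v, r v = 0%N) -> fire r c = c.
Proof.
move=> r0; case: c => x rho; congr (_, _); apply/ffunP => u; rewrite !ffunE /= r0.
  rewrite (_ : departures _ 0 = 0%N) ?subr0; last by case: (rho u).
  rewrite big1 ?addr0 // => v _; rewrite r0 /arrivals.
  by case: (rho v) => // e; rewrite big_ord0.
by case: (rho u).
Qed.

Lemma route_fire v r c :
  route v (fire r c) = fire (fun u => (u == v) + r u)%N c.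
Proof.
rewrite /route /= ffunE; case Ev: (c.2 v) => [e|] /=; last first.
  by apply: eq_fire => u; case: eqP => [->|//]; rewrite Ev.
congr (_, _); apply/ffunP => u; rewrite !ffunE; last first.
  by case: eqP => [->|//]; rewrite Ev.
rewrite (bigD1 v) //= [in RHS](bigD1 v) //= Ev eqxx /= big_ord_recr /=.
have -> : (\sum_(w | w != v) arrivals (c.2 w) ((w == v) + r w) u
           = \sum_(w | w != v) arrivals (c.2 w) (r w) u)%N.
  by apply: eq_bigr => w /negPf ->.
by have [->|uv] := eqVneq u v; rewrite ?Ev ?add0n /= [_ == head _]eq_sym; lia.
Qed.

Lemma multirouteE (r : {ffun V -> nat}) c : multiroute r c = fire r c.
Proof.
(* Truncating [r] to the listed vertices makes the claim inductive in the list. *)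
rewrite /multiroute (_ : foldr _ _ _ =
  fire (fun v => if v \in enum V then r v else 0%N) c); last first.
  elim: (enum V) (enum_uniq V) => [_|v l IH /= /andP[vl /IH->]].
    by rewrite fire0.
  have: forall n, iter n (route v) (fire (fun u => if u \in l then r u else 0%N) c) =
    fire (fun u => if u == v then n else if u \in l then r u else 0%N) c.
    elim=> [|n /= ->].
      by apply: eq_fire => u _; case: eqP => // ->; rewrite (negPf vl).
    by rewrite route_fire; apply: eq_fire => u _; case: eqP.
  move=> ->; apply: eq_fire => u _; rewrite inE.
  by case: eqP => // ->.
by apply: eq_fire => v _; rewrite mem_enum.
Qed.

Lemma multiroute_route v (r : {ffun V -> nat}) c :
  multiroute r (route v c) = route v (multiroute r c).
Proof.
rewrite /multiroute; elim: (enum V) => //= u l ->.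
by elim: (r u) => //= n ->; rewrite routeC.
Qed.

(** * Chips sent into a set *)

Lemma arrivals_sum (A : {set V}) e n :
  (\sum_(u in A) arrivals (Some e) n u =
   \sum_(i < n) (head (iter i.+1 (enext G) e) \in A))%N.
Proof.
rewrite /= exchange_big /=; apply: eq_bigr => i _.
case: (boolP (_ \in A)) => [hA|hA].
  rewrite (bigD1 (head (enext G (iter i (enext G) e)))) //= eqxx big1 ?addn0 //.
  by move=> u /andP[_ /negPf]; rewrite eq_sym => ->.
by apply: big1 => u uA; case: eqP => // hu; rewrite hu uA in hA.
Qed.

Lemma arrivals_sum_le (A : {set V}) o n :
  (\sum_(u in A) arrivals o n u <= departures o n)%N.
Proof.
case: o => [e|]; last by rewrite big1.
rewrite arrivals_sum -[leqRHS](card_ord n) -sum1_card.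
by apply: leq_sum => i _; case: (_ \in A).
Qed.

(** The final rotor is the edge used last; if it points outside [A], that chip is lost to [A]. *)
Lemma arrivals_sum_lt (A : {set V}) e n :
  (0 < n)%N -> head (iter n (enext G) e) \notin A ->
  (\sum_(u in A) arrivals (Some e) n u < n)%N.
Proof.
case: n => // n _ hA; rewrite arrivals_sum big_ord_recr /= (negPf hA) addn0 ltnS.
rewrite -[leqRHS](card_ord n) -sum1_card.
by apply: leq_sum => i _; case: (_ \in A).
Qed.

(** * Full turns of a rotor *)

Lemma card_porbit_enext e : #|porbit (enext G) e| = outdeg (tail e).
Proof. by apply: eq_card => f; rewrite enext_cyclic inE. Qed.

Lemma iter_outdeg p e : iter (p * outdeg (tail e)) (enext G) e = e.
Proof.
rewrite -card_porbit_enext; elim: p => //= p IH.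
by rewrite mulSn iterD IH iter_porbit.
Qed.

Lemma arrivalsD e m n u :
  arrivals (Some e) (m + n) u =
  (arrivals (Some e) m u + arrivals (Some (iter m (enext G) e)) n u)%N.
Proof.
rewrite /= big_split_ord /=; congr addn; apply: eq_bigr => i _.
by rewrite addnC iterD.
Qed.

Lemma tail_enext e : tail (enext G e) = tail e.
Proof. by apply/eqP; rewrite -enext_cyclic -{1}[enext G]expg1 mem_porbit. Qed.

(** A full turn runs once through the orbit of [enext G e], that is, through every edge with the
    same tail. *)
Lemma arrivals_outdeg e u :
  arrivals (Some e) (outdeg (tail e)) u = mult (tail e) u.
Proof.
rewrite -tail_enext -card_porbit_enext /arrivals.
under eq_bigr do rewrite iterSr.
move: (enext G e) => f; rewrite /mult cardsE -[RHS]sum1_card.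
rewrite [RHS](eq_bigl (fun g => (g \in porbit (enext G) f) && (head g == u))); last first.
  by move=> g; rewrite enext_cyclic.
rewrite big_mkcondr [RHS](eq_bigl (mem (traject (enext G) f #|porbit (enext G) f|))); last first.
  by move=> g; rewrite porbit_traject.
rewrite -big_uniq ?uniq_traject_porbit // (big_nth f) size_traject big_mkord.
by apply: eq_bigr => i _; rewrite nth_traject //; case: (_ == u).
Qed.

Lemma tail_iter n e : tail (iter n (enext G) e) = tail e.
Proof. by elim: n => //= n <-; rewrite tail_enext. Qed.

Lemma arrivals_period p e n u :
  arrivals (Some e) (p * outdeg (tail e) + n) u =
  (p * mult (tail e) u + arrivals (Some e) n u)%N.
Proof.
elim: p => [|p IH]; first by rewrite !mul0n.
rewrite mulSn -addnA arrivalsD arrivals_outdeg.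
have := iter_outdeg 1 e; rewrite mul1n => ->.
by rewrite IH mulSn addnA.
Qed.

(** The first [outdeg (tail e)] iterates are distinct, so a rotor returns to its position only after
    full turns. *)
Lemma dvdn_outdeg_iter e a n :
  iter (a + n) (enext G) e = iter a (enext G) e -> (outdeg (tail e) %| n)%N.
Proof.
rewrite iterD -!permX => /perm_inj; rewrite permX.
have d_gt0 : (0 < outdeg (tail e))%N.
  by rewrite -card_porbit_enext lt0n; apply/eqP => /card0_eq/(_ e); rewrite porbit_id.
rewrite {1}(divn_eq n (outdeg (tail e))) addnC iterD iter_outdeg => eq_e.
have := uniq_traject_porbit (enext G) e; rewrite card_porbit_enext => uq.
have := nth_uniq e _ _ uq; rewrite size_traject => /(_ (n %% outdeg (tail e))%N 0%N).
by rewrite ltn_mod !nth_traject ?ltn_mod // eq_e eqxx => /(_ d_gt0 d_gt0) /esym.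
Qed.

(** * Period vectors *)

Lemma sum_mult v : (\sum_u mult v u = outdeg v)%N.
Proof.
rewrite /outdeg -sum1_card (partition_big head xpredT) //=.
apply: eq_bigr => u _; rewrite /mult -sum1_card.
by apply: eq_bigl => e; rewrite !inE.
Qed.

Lemma mult_loop v : mult v v = 0%N.
Proof.
apply/eqP; rewrite cards_eq0 -subset0; apply/subsetP => e; rewrite inE.
by case/andP => /eqP tv /eqP hv; have := no_loop e; rewrite tv hv eqxx.
Qed.

(** The kernel condition as conservation of chips when each [v] makes [p v] full turns. *)
Lemma period_vectorP (p : {ffun V -> nat}) :
  period_vector p <-> forall u, (\sum_v p v * mult v u = p u * outdeg u)%N.
Proof.
have lapE u : \sum_v laplacian u v * (p v)%:Z =
    (\sum_v p v * mult v u)%:Z - (p u * outdeg u)%N%:Z.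
  rewrite (bigD1 u) //= /laplacian eqxx [in RHS](bigD1 u) //= mult_loop muln0 add0n.
  rewrite PoszM mulNr [_ * (p u)%:Z]mulrC addrC; congr (_ - _).
  rewrite -[RHS]natz natr_sum; apply: eq_bigr => v /negPf.
  by rewrite eq_sym => ->; rewrite natz PoszM mulrC.
split=> H u; have := H u; rewrite ?lapE; lia.
Qed.

Lemma rotor_tail (rho : {ffun V -> option E}) v e :
  is_rotor rho -> rho v = Some e -> tail e = v.
Proof. by move=> /forallP/(_ v); case: (rho v) => // f /eqP <- [->]. Qed.

Lemma rotor_sink (rho : {ffun V -> option E}) v :
  is_rotor rho -> sink v = ~~ isSome (rho v).
Proof.
move=> /forallP/(_ v); case: (rho v) => [e /eqP tv|->//].
by apply/negbTE; rewrite /sink cards_eq0; apply/set0Pn; exists e; rewrite inE tv.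
Qed.

Section Rotor.
Variables (rho : {ffun V -> option E}) (rhoP : is_rotor rho).

Lemma departures_period p v n :
  departures (rho v) (p * outdeg v + n) = (p * outdeg v + departures (rho v) n)%N.
Proof.
have := rotor_sink rho v rhoP; case: (rho v) => //= /eqP ->.
by rewrite muln0.
Qed.

Lemma rotor_arrivals_period p v n u :
  arrivals (rho v) (p * outdeg v + n) u = (p * mult v u + arrivals (rho v) n u)%N.
Proof.
case rv : (rho v) => [e|]; first by rewrite -(rotor_tail _ _ _ rhoP rv) arrivals_period.
have /eqP : sink v by rewrite (rotor_sink rho) // rv.
rewrite -sum_mult => /eqP; rewrite sum_nat_eq0 => /forallP/(_ u) /eqP ->.
by rewrite muln0.
Qed.

Lemma rotor_period p v n :
  omap (iter (p * outdeg v + n) (enext G)) (rho v) = omap (iter n (enext G)) (rho v).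
Proof.
case rv : (rho v) => [e|] //=.
by rewrite addnC iterD -(rotor_tail _ _ _ rhoP rv) iter_outdeg.
Qed.

End Rotor.

(** Full turns restore all rotors, and by [period_vectorP] every vertex receives as many chips as it
    sends. *)
Lemma fire_period (p : {ffun V -> nat}) r c :
  is_rotor c.2 -> period_vector p ->
  fire (fun v => p v * outdeg v + r v)%N c = fire r c.
Proof.
move=> cP /period_vectorP pP; congr (_, _); apply/ffunP => u; rewrite !ffunE.
  rewrite departures_period //.
  under eq_bigr do rewrite rotor_arrivals_period //.
  by rewrite big_split /= pP; lia.
by rewrite rotor_period.
Qed.

(** * Routing reduced vectors *)

(* If firing [s] and [r] have the same effect, then [s - r] is [outdeg * (k - m)]
   with [k] and [m] of disjoint supports and [k - m] in the kernel of the
   Laplacian; both [k] and [m] are then in the kernel, whence [m = 0]. *)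
Lemma routing_reduced_le (r : {ffun V -> nat}) s c :
  is_rotor c.2 -> routing_reduced r -> fire s c = fire r c ->
  forall v, (r v <= s v)%N.
Proof.
move=> cP [r_sink r_min] [eq_chips eq_rotors].
(* Truncated subtraction makes one of [m v] and [k v] vanish; where there is a rotor, equality of
   the final rotors makes both divisions exact. *)
pose m : {ffun V -> nat} := [ffun v => ((r v - s v) %/ outdeg v)%N].
pose k v := ((s v - r v) %/ outdeg v)%N.
have km v : isSome (c.2 v) -> (m v * outdeg v + s v = k v * outdeg v + r v)%N.
  have /ffunP/(_ v) := eq_rotors; rewrite !ffunE.
  case cv : (c.2 v) => [e|] //= [eq_e] _.
  have tv := rotor_tail _ _ _ cP cv; rewrite /k; case: (leqP (r v) (s v)) => rs.
    rewrite (eqP rs) div0n -{1}(subnK rs) divnK //.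
    by have := dvdn_outdeg_iter e (r v) (s v - r v); rewrite tv subnKC // => ->.
  have sr := ltnW rs; rewrite (eqP sr) div0n divnK ?subnK //.
  by have := dvdn_outdeg_iter e (s v) (r v - s v); rewrite tv subnKC // => ->.
have balance u : (\sum_v m v * mult v u + k u * outdeg u =
                  \sum_v k v * mult v u + m u * outdeg u)%N.
  have dep : (m u * outdeg u + departures (c.2 u) (s u) =
              k u * outdeg u + departures (c.2 u) (r u))%N.
    rewrite -!departures_period //.
    by have := km u; case: (c.2 u) => //= e ->.
  have arr : (\sum_v m v * mult v u + \sum_v arrivals (c.2 v) (s v) u =
              \sum_v k v * mult v u + \sum_v arrivals (c.2 v) (r v) u)%N.
    rewrite -!big_split /=; apply: eq_bigr => v _.
    rewrite -!rotor_arrivals_period //.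
    by have := km v; case: (c.2 v) => //= e ->.
  by have /ffunP/(_ u) := eq_chips; rewrite [in X in X -> _]ffunE [in X in X -> _]ffunE; lia.
(* Either [m u = 0], or [k u = 0] and [balance] gives the bound. *)
have m_le u : (m u * outdeg u <= \sum_v m v * mult v u)%N.
  have := balance u; rewrite /k; case: (leqP (r u) (s u)) => rs.
    by rewrite {3}/m ffunE (eqP rs) div0n.
  by rewrite (eqP (ltnW rs)) div0n; lia.
have m_period : period_vector m.
  apply/period_vectorP => u; apply/esym/eqP.
  (* Both sides of [m_le] have the same total over [u], by [sum_mult], so each inequality is an
     equality. *)
  have [_] := @leqif_sum _ xpredT _ _ _ (fun u _ => leqif_eq (m_le u)).
  rewrite exchange_big /=; under [X in _ == X]eq_bigr do rewrite -big_distrr sum_mult.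
  by rewrite eqxx => /esym/forallP/(_ u).
have m0 v : (m v * outdeg v = 0)%N.
  have q0 : [ffun v => (m v * outdeg v)%N] = [ffun=> 0%N].
    apply/eqP; apply: contraT => /eqP q_neq0.
    case: (r_min _ _ q_neq0); first by exists m.
    by move=> w; rewrite !ffunE (leq_trans (leq_trunc_div _ _)) ?leq_subr.
  by have /ffunP/(_ v) := q0; rewrite !ffunE.
move=> v; case: (boolP (sink v)) => [/r_sink -> //|].
rewrite (rotor_sink c.2) // negbK => /km; rewrite m0; lia.
Qed.

(** A vector of least total works: clearing an entry at a sink or subtracting a routing period
    vector keeps the effect. *)
Lemma routing_reduced_exists c c' :
  is_rotor c.2 -> unconstrained_reachable c c' ->
  exists2 r, routing_reduced r & multiroute r c = c'.
Proof.
move=> cP [r0 r0c].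
(* Bounding entries by the total of [r0] makes the search space finite. *)
pose N := (\sum_v r0 v)%N.
pose up (r : {ffun V -> 'I_N.+1}) : {ffun V -> nat} := [ffun v => val (r v)].
pose P (r : {ffun V -> 'I_N.+1}) := multiroute (up r) c == c'.
have upK (r : {ffun V -> nat}) : (\sum_v r v <= N)%N -> up [ffun v => inord (r v)] = r.
  move=> rN; apply/ffunP => v; rewrite !ffunE /= inordK // ltnS.
  by apply: leq_trans rN; rewrite (bigD1 v) //= leq_addr.
have P0 : P [ffun v => inord (r0 v)] by rewrite /P upK // r0c.
case: (arg_minnP (fun r : {ffun V -> 'I_N.+1} => (\sum_v up r v)%N) P0) => r1 /eqP r1c r1_min.
have min1 (r : {ffun V -> nat}) : (forall v, (r v <= up r1 v)%N) ->
    multiroute r c = c' -> r = up r1.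
  move=> le_r rc; apply/ffunP => v; apply/eqP.
  have le_sum : (\sum_v r v <= \sum_v up r1 v)%N by apply: leq_sum.
  have rN : (\sum_v r v <= N)%N.
    by apply: leq_trans le_sum _; have := r1_min _ P0; rewrite upK.
  have := r1_min [ffun v => inord (r v)]; rewrite /P upK // rc eqxx => /(_ isT) ge_sum.
  have [_] := @leqif_sum _ xpredT _ _ _ (fun v _ => leqif_eq (le_r v)).
  by rewrite eqn_leq le_sum ge_sum => /esym/forallP/(_ v).
exists (up r1) => //; split=> [v v_sink | q [p pP ->] q_neq0 q_le].
  pose r : {ffun V -> nat} := [ffun w => if w == v then 0%N else up r1 w].
  have <- : r = up r1; last by rewrite ffunE eqxx.
  apply: min1 => [w|]; first by rewrite ffunE; case: eqP.
  rewrite -r1c !multirouteE; apply: eq_fire => w; rewrite ffunE; case: eqP => // ->.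
  by move: v_sink; rewrite (rotor_sink c.2) // => /negPf ->.
have eq_r : [ffun v => (up r1 v - p v * outdeg v)%N] = up r1.
  apply: min1 => [v|]; first by rewrite ffunE leq_subr.
  rewrite -r1c !multirouteE -(fire_period p) //; apply: eq_fire => v _.
  by rewrite ffunE subnKC //; have := q_le v; rewrite ffunE.
case: q_neq0; apply/ffunP => v.
have /ffunP/(_ v) := eq_r; have := q_le v; rewrite !ffunE; lia.
Qed.

(** * Necessary conditions from a legal game *)

(* [s] counts effective routings only: routings at sinks are left out. *)
Lemma leadsto_fire c c' : is_rotor c.2 -> leadsto c c' -> exists s,
  [/\ c' = fire s c,
      forall v, (0 < s v)%N -> 0 <= c'.1 v
    & forall R : {set V}, R != set0 -> (forall v, v \in R -> 0 < s v)%N ->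
        (forall u w, u \in R -> rotor_edge c'.2 u w -> w \in R) ->
        exists2 w, w \in R & 0 < c'.1 w].
Proof.
move=> cP [l]; elim/last_ind: l c' => [|l c'' IH] c' /=.
  move=> _ <-; exists (fun=> 0%N); split=> //; first by rewrite fire0.
  by move=> R /set0Pn[v vR] /(_ v vR).
rewrite rcons_path last_rcons => /andP[/IH/(_ erefl) [s [c1E s_ge0 s_gt0]]].
move=> /existsP[v /andP[v_gt0 /eqP c''E]] <-; set c1 := last c l in c1E s_ge0 s_gt0 v_gt0 c''E.
case c1v : (c1.2 v) => [e|]; last first.
  have -> : c'' = c1 by rewrite c''E /route c1v.
  by exists s.
pose h := head (enext G e).
have chips u : c''.1 u = c1.1 u - (u == v)%:Z + (u == h)%:Z.
  by rewrite c''E /route c1v ffunE.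
have rotors u : c''.2 u = if u == v then Some (enext G e) else c1.2 u.
  by rewrite c''E /route c1v ffunE.
exists (fun u => (u == v) + s u)%N; split=> [|u|R R_neq0 R_gt0 R_closed].
- by rewrite c''E c1E route_fire.
- by rewrite chips; case: eqP => [-> _|_ /s_ge0]; lia.
have tv : tail (enext G e) = v.
  move: c1v; rewrite tail_enext c1E ffunE; case cv : (c.2 v) => [f|] //= [<-].
  by rewrite tail_iter (rotor_tail _ _ _ cP cv).
have hv : h != v by rewrite -tv eq_sym no_loop.
case: (boolP (v \in R)) => vR.
  (* The new rotor of [v] keeps [h] in [R]; as [h] differs from [v], it was routed earlier, had a
     nonnegative count and has just gained a chip. *)
  have hR : h \in R by apply: (R_closed v) => //; rewrite /rotor_edge /= rotors eqxx.
  exists h => //; rewrite chips (negPf hv) eqxx.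
  by have := R_gt0 h hR; rewrite (negPf hv) => /s_ge0; lia.
have neq_v u : u \in R -> (u == v) = false.
  by move=> uR; apply: contraNF vR => /eqP <-.
(* The last routing changed no rotor in [R] and took no chip from it. *)
case: (s_gt0 R) => // [u uR|u w uR|w wR w_gt0].
- by have := R_gt0 u uR; rewrite neq_v.
- by move=> uw; apply: (R_closed u) => //; move: uw; rewrite /rotor_edge /= rotors neq_v.
by exists w => //; rewrite chips neq_v //; lia.
Qed.

(** * Greedy construction of a legal game *)

Lemma routable_vertex (r : {ffun V -> nat}) c c' :
  fire r c = c' -> S1 c'.1 r = set0 -> S2 c'.1 c'.2 r = set0 ->
  (exists v, 0 < r v)%N -> exists v, (0 < r v)%N && (0 < c.1 v).
Proof.
move=> rc S1_0 S2_0 [v0 v0_gt0]; apply/existsP; apply: contraT.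
rewrite negb_exists => /forallP stuck.
pose W := [set v | (0 < r v)%N].
have x_le0 v : v \in W -> c.1 v <= 0.
  by have := stuck v; rewrite inE leNgt negb_and => /orP[/negPf->|].
have y_ge0 v : v \in W -> 0 <= c'.1 v.
  rewrite inE leNgt => rv; apply/negP => yv.
  have : v \in S1 c'.1 r by rewrite inE yv rv.
  by rewrite S1_0 inE.
have r0 v : v \notin W -> r v = 0%N by rewrite inE lt0n negbK => /eqP.
have dep0 o : departures o 0 = 0%N by case: o.
(* All departures happen in [W], so its total changes by arrivals in [W] minus all departures. *)
have sumE : \sum_(u in W) c'.1 u = \sum_(u in W) c.1 u +
   ((\sum_v \sum_(u in W) arrivals (c.2 v) (r v) u)%:Z
    - (\sum_v departures (c.2 v) (r v))%:Z).
  have -> : (\sum_v departures (c.2 v) (r v) =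
             \sum_(v in W) departures (c.2 v) (r v))%N.
    by rewrite [RHS]big_mkcond; apply: eq_bigr => v _; case: ifPn => // /r0 ->.
  rewrite exchange_big /= -!natz !natr_sum -sumrB -big_split -rc.
  by apply: eq_bigr => u _; rewrite !ffunE /= !natz; lia.
have sx_le0 : \sum_(u in W) c.1 u <= 0 by apply: sumr_le0.
have arr_le v : (\sum_(u in W) arrivals (c.2 v) (r v) u <= departures (c.2 v) (r v))%N.
  exact: arrivals_sum_le.
have sarr_le : (\sum_v \sum_(u in W) arrivals (c.2 v) (r v) u <=
                \sum_v departures (c.2 v) (r v))%N by apply: leq_sum.
(* The final total on [W] is at most 0, while its terms are nonnegative. *)
have y0 v : v \in W -> c'.1 v = 0.
  have /psumr_eq0P : forall u, u \in W -> 0 <= c'.1 u by exact: y_ge0.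
  apply; apply/eqP; rewrite eq_le sumr_ge0 // andbT sumE; lia.
(* With final total 0, neither the initial total nor the chip balance can be negative, so no chip
   leaves [W]. *)
have arr_eq v : (\sum_(u in W) arrivals (c.2 v) (r v) u == departures (c.2 v) (r v))%N.
  have [_ sum_eq] := @leqif_sum _ xpredT _ _ _ (fun v _ => leqif_eq (arr_le v)).
  have /forallP/(_ v) // : is_true [forall v,
    \sum_(u in W) arrivals (c.2 v) (r v) u == departures (c.2 v) (r v)]%N.
  rewrite -sum_eq eqn_leq sarr_le /=.
  by move: sumE; rewrite big1 //; lia.
have W_closed u w : u \in W -> rotor_edge c'.2 u w -> w \in W.
  move=> uW; rewrite /rotor_edge /= -rc ffunE; have := arr_eq u; case: (c.2 u) => //= e /eqP eq_r.
  move=> /eqP <-; apply: contraT => hW.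
  by have := arrivals_sum_lt W e (r u); rewrite eq_r ltnn => -> //; move: uW; rewrite inE.
have TW v : v \in W -> v \in Tset c'.1 r.
  by move=> vW; rewrite inE y0 // eqxx; move: vW; rewrite inE.
suff : v0 \in S2 c'.1 c'.2 r by rewrite S2_0 inE.
have v0W : v0 \in W by rewrite inE.
rewrite inE TW //; apply/forallP => w; apply/implyP => /connectP[l].
elim: l v0 v0W {v0_gt0} => [|u l IH] v vW /= => [_ ->|/andP[vu]]; first exact: TW.
exact/IH/(W_closed v).
Qed.

(** Induction on the total of [r]: a legal routing at [v] lowers [r v] by one and keeps the target.
    [S1] and [S2] can only shrink, since both are monotone in the support of [r]. *)
Lemma leadsto_multiroute (r : {ffun V -> nat}) c c' :
  multiroute r c = c' -> S1 c'.1 r = set0 -> S2 c'.1 c'.2 r = set0 -> leadsto c c'.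
Proof.
have [n] := ubnP (\sum_v r v)%N; elim: n r c => // n IH r c le_n rc S1_0 S2_0.
case: (boolP [exists v, 0 < r v]%N) => [/existsP r_gt0 | r_le0]; last first.
  exists [::] => //=; rewrite -rc multirouteE fire0 // => v.
  by move: r_le0; rewrite negb_exists => /forallP/(_ v); rewrite lt0n negbK => /eqP.
have [v /andP[rv xv]] : exists v, (0 < r v)%N && (0 < c.1 v).
  by apply: (routable_vertex r c c'); rewrite -?multirouteE.
pose r' : {ffun V -> nat} := [ffun u => (r u - (u == v))%N].
have r'_gt0 u : (0 < r' u -> 0 < r u)%N by rewrite ffunE; lia.
have subT : Tset c'.1 r' \subset Tset c'.1 r.
  by apply/subsetP => u; rewrite !inE => /andP[-> /r'_gt0].
have [l lP lE] : leadsto (route v c) c'.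
  apply: (IH r').
  - rewrite -ltnS (leq_trans _ le_n) // ltnS (bigD1 v) //= [ltnRHS](bigD1 v) //=.
    rewrite ffunE eqxx (eq_bigr r) => [|u /negPf uv]; last by rewrite ffunE uv subn0.
    by rewrite ltn_add2r subn1 ltn_predL.
  - rewrite multiroute_route multirouteE route_fire -rc multirouteE.
    by apply: eq_fire => u _; rewrite ffunE; case: eqP => [->|]; lia.
  - apply/eqP; rewrite -subset0 -S1_0; apply/subsetP => u.
    by rewrite !inE => /andP[-> /r'_gt0].
  apply/eqP; rewrite -subset0 -S2_0; apply/subsetP => u.
  rewrite inE => /andP[/(subsetP subT) uT /forallP closed_u]; rewrite inE uT.
  apply/forallP => w; apply/implyP => uw.
  exact/(subsetP subT)/(implyP (closed_u w)).
exists (route v c :: l) => //=; rewrite lP andbT.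
by apply/existsP; exists v; rewrite xv eqxx.
Qed.

End RotorRouting.

Theorem theorem3p4 (G : ribbon_digraph)
    (x y : {ffun vertex G -> int})
    (rhox rhoy : {ffun vertex G -> option (edge G)})
    (rhoxP : is_rotor rhox) (rhoyP : is_rotor rhoy) :
  leadsto (x, rhox) (y, rhoy) <->
  unconstrained_reachable (x, rhox) (y, rhoy) /\
  (forall r : {ffun vertex G -> nat},
     routing_reduced r -> multiroute r (x, rhox) = (y, rhoy) ->
     S1 y r = set0 /\ S2 y rhoy r = set0).
Proof.
split=> [/leadsto_fire[//|s [yE s_ge0 s_gt0]] | [reach cond]]; last first.
  have [//|r r_red rx] := routing_reduced_exists _ _ _ _ reach.
  by have [S1_0 S2_0] := cond r r_red rx; apply: leadsto_multiroute rx S1_0 S2_0.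
split=> [|r r_red rx].
  exists [ffun v => s v]; rewrite multirouteE yE.
  by apply: eq_fire => v _; rewrite ffunE.
(* The reduced vector lies below the routing vector of the game, so its support was routed
   legally. *)
have r_le v : (0 < r v -> 0 < s v)%N.
  move=> /leq_trans; apply; apply: (routing_reduced_le _ r s (x, rhox)) => //.
  by rewrite -yE -multirouteE.
split; apply/eqP; rewrite -subset0; apply/subsetP => v; rewrite !inE.
  by case/andP => yv /r_le /s_ge0; rewrite leNgt yv.
case/andP => vT /forallP v_closed.
(* The vertices reachable from a [v] in [S2] form a closed set inside [T], where no count is
   positive, contradicting [s_gt0]. *)
pose R := [set w | connect (rotor_edge rhoy) v w].
have RT w : w \in R -> (y w == 0) && (0 < r w)%N.
  by rewrite inE => /(implyP (v_closed w)); rewrite inE.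
case: (s_gt0 R) => [|w /RT/andP[_ /r_le]|u w|w /RT/andP[/eqP /= ->]] //.
  by apply/set0Pn; exists v; rewrite inE.
by rewrite !inE => vu uw; apply: connect_trans vu (connect1 uw).
Qed.
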